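(* Let $\Gamma$ be a finite topological network with edges $e_j$ ($j\in J$), vertex set $V$, boundary vertices $v_i$ ($i\in I_B$) and transition vertices $v_i$ ($i\in I_T$). Let $\beta_{ij}>0$ for every $i\in I_T$, $j\in Inc_i$, and let $g_i\in\mathbb{R}$ for $i\in I_B$. Let $H=(H^j)_{j\in J}$ be a Hamiltonian such that: (1) $H^j\in C^0([0,l_j]\times\mathbb{R}\times\mathbb{R})$ for $j\in J$; (2) $H^j(x,\cdot,p)$ is nondecreasing for all $(x,p)\in[0,l_j]\times\mathbb{R}$, $j\in J$; (3) $H^j(v_i,r,\cdot)$ is nondecreasing in $(0,+\infty)$ for any $i\in I_T$, $j\in Inc_i$, $r\in\mathbb{R}$; (4) for every $R>0$ and $j\in J$, $H^j(x,r,p)\to+\infty$ as $|p|\to\infty$ uniformly in $(x,r)\in[0,l_j]\times[-R,R]$; (5) at least one of the following holds: (a) $H^j(x,\cdot,\cdot)\in C^1(\mathbb{R}\times\mathbb{R})$ for any $x\in(0,l_j)$, $j\in J$; (b) $H^j(y,\cdot,p)$ is strictly increasing for any $y\in[0,l_j]$, $p\in\mathbb{R}$, $j\in J$; (c) there is a constant $K$ such that $|H^j(x,r,p)-H^j(x,s,q)|\le K(|r-s|+|p-q|)$ for all $r,s,p,q\in\mathbb{R}$, $x\in[0,l_j]$, $j\in J$. Assume moreover that there exist $\delta>0$ and $\psi\in C^2(\Gamma)$ such that $H(x,\psi,\partial\psi)\le-\delta$ on $\Gamma\setminus V$, $S^i_\beta\psi\ge0$ for $i\in I_T$, and $\psi(v_i)=g_i$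 for $i\in I_B$. Assume that for each $\varepsilon>0$ there is a solution $u_\varepsilon\in C^2_{*,\beta}(\Gamma)$ of $$-\varepsilon\,\partial_j^2 u_\varepsilon+H^j(x,u_\varepsilon,\partial_j u_\varepsilon)=0\ \ (x\in e_j,\ j\in J),\qquad S^i_\beta u_\varepsilon=0\ \ (i\in I_T),\qquad u_\varepsilon(v_i)=g_i\ \ (i\in I_B).$$ Then there is $\bar\varepsilon>0$ sufficiently small such that the functions $u_\varepsilon$, $0<\varepsilon<\bar\varepsilon$, are uniformly bounded and equi-Lipschitz continuous on $\Gamma$.
   Context: Topological network: let $V=\{v_i: i\in I\}$ be a finite set of points of $\mathbb{R}^n$ and $\pi_j:[0,l_j]\to\mathbb{R}^n$, $l_j>0$, $j\in J$ ($J$ finite), smooth non-self-intersecting curves; put $e_j:=\pi_j((0,l_j))$, $\bar e_j:=\pi_j([0,l_j])$. Assume: (i) $\pi_j(0),\pi_j(l_j)\in V$ and $\#(\bar e_j\cap V)=2$ for all $j$; (ii) $\bar e_j\cap\bar e_k\subset V$ and $\#(\bar e_j\cap\bar e_k)\le 1$ for $j\ne k$; (iii) any two vertices are joined by a path of edges. Then $\Gamma:=\bigcup_{j\in J}\bar e_j$. A point $x\in\bar e_j$ is identified with $\pi_j^{-1}(x)\in[0,l_j]$; Lipschitz continuity on $\Gamma$ refers to the path distance, with lengths along edges measured in the parameters $y\in[0,l_j]$. $Inc_i:=\{j\in J: e_j\text{ is incident to }v_i\}$. The signed incidence matrix is $a_{ij}=1$ if $v_i\in\bar e_j$ and $\pi_j(0)=v_i$,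 $a_{ij}=-1$ if $v_i\in\bar e_j$ and $\pi_j(l_j)=v_i$, $a_{ij}=0$ otherwise. A nonempty set $I_B\subset I$ is fixed, containing every $i$ with $\#Inc_i=1$; moreover it is assumed that $\#Inc_i=1$ for every $i\in I_B$. $\partial\Gamma:=\{v_i:i\in I_B\}$ (boundary vertices), $I_T:=I\setminus I_B$ (transition vertices). Function spaces: for $u:\Gamma\to\mathbb{R}$, $u^j:=u\circ\pi_j:[0,l_j]\to\mathbb{R}$, and $\partial_j^\alpha u(x):=\frac{d^\alpha u^j}{dy^\alpha}(\pi_j^{-1}(x))$ for $x\in e_j$ or $x=v_i$ with $j\in Inc_i$ (one-sided at endpoints). $u\in C^k(\Gamma)$ means $u$ is continuous on $\Gamma$ and $u^j\in C^k([0,l_j])$ for all $j\in J$. For $i\in I_T$, $S^i_\beta u:=\sum_{j\in Inc_i}\beta_{ij}a_{ij}\partial_ju(v_i)$, and $C^k_{*,\beta}(\Gamma)$ ($k\ge 1$) is the set of $u\in C^k(\Gamma)$ with $S^i_\beta u=0$ for all $i\in I_T$. A Hamiltonian $H$ on $\Gamma$ is a collection $(H^j)_{j\in J}$ with $H^j:[0,l_j]\times\mathbb{R}\times\mathbb{R}\to\mathbb{R}$; $H(x,\psi,\partial\psi)$ at $x\in e_j$ means $H^j(x,\psi^j(x),\partial_j\psi(x))$. *)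

(* Defs.v *)
From HB Require Import structures.
From mathcomp Require Import all_boot all_order all_algebra.
From mathcomp Require Import all_classical all_reals all_analysis.
Set Implicit Arguments.
Unset Strict Implicit.
Unset Printing Implicit Defensive.
Import Order.TTheory GRing.Theory Num.Theory.
Import numFieldNormedType.Exports.
Local Open Scope classical_set_scope.
Local Open Scope ring_scope.

Section IntervalCalculus.
Context {R : realType}.
Implicit Types (l y : R) (f : R -> R) (k m : nat).

(* The limits are taken inside [0, l], hence are one-sided at 0 and l;
   derive1 would see the values of f outside [0, l]. *)
Definition diff_quot_lim l f y : set_system R :=
  (fun z => (f z - f y) / (z - y)) @ within `[0, l] y^'.

Definition iderivable l f y : Prop := cvg (diff_quot_lim l f y).

Definition iderive l f : R -> R := fun y => lim (diff_quot_lim l f y).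

Definition iderive_n k l f : R -> R := iter k (iderive l) f.

Definition Ck_on k l f : Prop :=
  (forall m, (m < k)%N -> forall y, y \in `[0, l] -> iderivable l (iderive_n m l f) y) /\
  (forall m, (m <= k)%N -> {within `[0, l], continuous (iderive_n m l f)}).

Definition smooth_curve n l (c : R -> 'rV[R]_n) : Prop :=
  forall k (i : 'I_n), Ck_on k l (fun y => c y 0 i).

Definition C1_plane (F : R * R -> R) : Prop :=
  (forall z, differentiable F z) /\
  (forall h, continuous (fun z => 'd F z h)).

End IntervalCalculus.

Record network_data (R : realType) (n : nat) := NetworkData {
  vertex : finType;
  edge : finType;
  pos : vertex -> 'rV[R]_n;
  len : edge -> R;
  curve : edge -> R -> 'rV[R]_n
}.

Section Network.
Context {R : realType} {n : nat}.
Variable G : network_data R n.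
Implicit Types (i : vertex G) (j : edge G) (x y : 'rV[R]_n) (k : nat)
  (u : 'rV[R]_n -> R).

Definition vertices : set 'rV[R]_n := range (@pos R n G).

Definition open_edge j : set 'rV[R]_n := curve j @` `]0, len j[.

Definition closed_edge j : set 'rV[R]_n := curve j @` `[0, len j].

Definition Gamma : set 'rV[R]_n := \bigcup_j closed_edge j.

Definition Inc i : {set edge G} := [set j | pos i \in closed_edge j]%SET.

Definition adjacent : rel (vertex G) :=
  fun i i' => [exists j, (j \in Inc i) && (j \in Inc i')].

Record topological_network : Prop := TopologicalNetwork {
  net_pos_inj : injective (@pos R n G);
  net_len_gt0 : forall j, 0 < len j;
  net_smooth : forall j, smooth_curve (len j) (curve j);
  net_simple : forall j, {in `[0, len j] &, injective (curve j)};
  net_ends : forall j, vertices (curve j 0) /\ vertices (curve j (len j));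
  net_two_vertices : forall j, (closed_edge j `&` vertices #= `I_2)%card;
  net_meet_vertices : forall j j', j != j' ->
    closed_edge j `&` closed_edge j' `<=` vertices;
  net_meet_le1 : forall j j', j != j' ->
    (closed_edge j `&` closed_edge j' #<= `I_1)%card;
  net_connected : forall i i', connect adjacent i i'
}.

Definition signed_incidence i j : R :=
  if curve j 0 == pos i then 1
  else if curve j (len j) == pos i then -1
  else 0.

Definition boundary_indices (IB : {set vertex G}) : Prop :=
  [/\ exists i, i \in IB,
      forall i, #|Inc i| = 1%N -> i \in IB &
      forall i, i \in IB -> #|Inc i| = 1%N].

(* the inverse of curve j on closed_edge j (junk value elsewhere) *)
Definition param j x : R :=
  xget 0 [set t | t \in `[0, len j] /\ curve j t = x].

(* Functions on the network are functions on the ambient space of which only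
   the values on Gamma matter. *)
Definition on_edge u j : R -> R := u \o curve j.

Definition pderive k j u x : R := iderive_n k (len j) (on_edge u j) (param j x).

Definition Ck_net k u : Prop :=
  {within Gamma, continuous u} /\ forall j, Ck_on k (len j) (on_edge u j).

Definition kirchhoff (beta : vertex G -> edge G -> R) i u : R :=
  \sum_(j in Inc i) beta i j * signed_incidence i j * pderive 1 j u (pos i).

Definition Ck_star (beta : vertex G -> edge G -> R) (IB : {set vertex G}) k u :
  Prop := Ck_net k u /\ forall i, i \notin IB -> kirchhoff beta i u = 0.

(* walk_length x y r: a finite walk from x to y in Gamma, each step of which
   moves along one closed edge, has total length r, measured in the parameters. *)
Inductive walk_length : 'rV[R]_n -> 'rV[R]_n -> R -> Prop :=
| walk_refl x : Gamma x -> walk_length x x 0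
| walk_step j s t y r : s \in `[0, len j] -> t \in `[0, len j] ->
    walk_length (curve j t) y r ->
    walk_length (curve j s) y (`|s - t| + r).

Definition path_dist x y : R := inf [set r | walk_length x y r].

Definition net_lipschitz (L : R) u : Prop :=
  forall x y, Gamma x -> Gamma y -> `|u x - u y| <= L * path_dist x y.

Definition hamiltonian := edge G -> R -> R -> R -> R.

Definition hamiltonian_at (H : hamiltonian) j u x : R :=
  H j (param j x) (u x) (pderive 1 j u x).

Definition viscous_solution (H : hamiltonian) (beta : vertex G -> edge G -> R)
    (IB : {set vertex G}) (g : vertex G -> R) (eps : R) u : Prop :=
  [/\ forall j x, open_edge j x ->
        - eps * pderive 2 j u x + hamiltonian_at H j u x = 0,
      forall i, i \notin IB -> kirchhoff beta i u = 0 &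
      forall i, i \in IB -> u (pos i) = g i].

End Network.

(* Main.v *)
Require Import Defs.
From HB Require Import structures.
From mathcomp Require Import all_boot all_order all_algebra.
From mathcomp Require Import all_classical all_reals all_analysis.
From mathcomp Require Import ring lra.
Import Order.TTheory GRing.Theory Num.Theory.
Import numFieldNormedType.Exports.
Local Open Scope classical_set_scope.
Local Open Scope ring_scope.

(** Why the family is bounded and equi-Lipschitz.

    Lower barrier. For small eps the function psi is a strict subsolution of
    the viscous equation as well. At a negative minimum of u - psi over the
    network the first derivatives agree along the edge considered (at a
    transition vertex because of the two Kirchhoff conditions), and the equation
    then makes the second derivative of u - psi negative: a contradiction. So
    psi <= u (comparison_strict_subsolution), and u is bounded below
    independently of eps.

    Steep slopes climb. With u >= - A, coercivity and monotonicity give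
    H(y, u, p) >= 1 for |p| >= P, so that u'' > 0 wherever |u'| >= P. Hence, in
    the direction in which u increases, a slope of size at least P only grows
    until the end of the edge (steep_edge_climbs), and the largest slopes on an
    edge are those at its ends with u increasing towards the vertex
    (edge_deriv_bound).

    Gradient bound. A large slope arriving at a transition vertex must, by the
    Kirchhoff condition, leave through another edge with a slope that is smaller
    by a factor depending on beta only (steep_exit); this is again steep and
    climbs to the next vertex. The values of u at the vertices met increase
    strictly, so after at most as many steps as there are vertices the chain
    stops at a boundary vertex, where u arrives with a large slope. But there
    u = psi and u >= psi, so this slope is at most that of psi. The result is a
    bound on all slopes that does not depend on eps (inward_deriv_ge).

    A bound on the slopes along the edges is a Lipschitz bound for the path
    distance (net_lipschitz_of_edges), and with the prescribed value at one
    boundary vertex it yields the uniform bound. *)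

Set Implicit Arguments.
Unset Strict Implicit.
Unset Printing Implicit Defensive.

(** * Calculus on a closed interval *)

Section IntervalDerivative.
Context {R : realType}.
Implicit Types (l a b d y z P L : R) (f g v w : R -> R).

(** A predicate rather than the value of a limit, so that the limit rules apply to
    combinations of functions without appeal to the uniqueness of limits. *)
Definition has_iderive l f y d : Prop := diff_quot_lim l f y --> d.

Lemma has_iderive_near l f y d e : has_iderive l f y d -> 0 < e ->
  exists2 eta, 0 < eta & forall z, z \in `[0, l] -> z != y -> `|z - y| < eta ->
    `|d - (f z - f y) / (z - y)| < e.
Proof.
move=> fd e0; move/cvgrPdist_lt : fd => /(_ e e0).
rewrite !near_withinE => /nbhs_ballP[eta /= eta0 h].
exists eta => // z zl zy zeta; apply: h => //=.
by rewrite /ball /= distrC.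
Qed.

Lemma has_iderive_continuous l f y d : has_iderive l f y d ->
  forall e, 0 < e -> exists2 eta, 0 < eta &
    forall z, z \in `[0, l] -> `|z - y| < eta -> `|f z - f y| < e.
Proof.
move=> /has_iderive_near /(_ (@ltr01 R)) [eta eta0 h] e e0.
have c0 : 0 < `|d| + 1 by rewrite ltr_wpDl.
exists (Num.min eta (e / (`|d| + 1))); first by rewrite lt_min eta0 divr_gt0.
move=> z zl; rewrite lt_min => /andP[z1 z2].
have [->|zy] := eqVneq z y; first by rewrite subrr normr0.
have zy0 : z - y != 0 by rewrite subr_eq0.
have q : `|(f z - f y) / (z - y)| < `|d| + 1.
  have := h z zl zy z1; set q := _ / _ => hq.
  have -> : q = d - (d - q) by ring.
  by apply: le_lt_trans (ler_normB _ _) _; rewrite ltrD2l.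
have -> : f z - f y = ((f z - f y) / (z - y)) * (z - y) by rewrite divfK.
rewrite normrM; apply: le_lt_trans (_ : (`|d| + 1) * `|z - y| < e).
  by rewrite ler_wpM2r// ltW.
by move: z2; rewrite ltr_pdivlMr// mulrC.
Qed.

Lemma within_continuous_iderive l f f1 a b : 0 <= a -> b <= l ->
  (forall y, y \in `[0, l] -> has_iderive l f y (f1 y)) ->
  {within `[a, b], continuous f}.
Proof.
move=> a0 bl df; apply/subspace_continuousP => y /= yab.
have sub z : z \in `[a, b] -> z \in `[0, l].
  by rewrite !in_itv /= => /andP[az zb]; rewrite (le_trans a0 az) (le_trans zb bl).
apply/cvgrPdist_lt => e e0.
have [eta eta0 h] := has_iderive_continuous (df y (sub y yab)) e0.
rewrite near_withinE; apply/nbhs_ballP; exists eta => //= z.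
by rewrite /ball /= distrC => zy zab; rewrite distrC; apply: h => //; exact: sub.
Qed.

Lemma has_iderive_add_scaled l f g y d d' c : has_iderive l f y d ->
  has_iderive l g y d' ->
  has_iderive l (fun z => f z + c * g z) y (d + c * d').
Proof.
move=> fd gd; rewrite /has_iderive /diff_quot_lim.
have -> : (fun z => (f z + c * g z - (f y + c * g y)) / (z - y)) =
  (fun z => (f z - f y) / (z - y) + c * ((g z - g y) / (z - y))).
  by apply/funext => z; ring.
by apply: cvgD => //; apply: cvgM => //; exact: cvg_cst.
Qed.

Lemma has_iderive_sub l f g y d d' : has_iderive l f y d ->
  has_iderive l g y d' -> has_iderive l (fun z => f z - g z) y (d - d').
Proof.
move=> fd gd; have := @has_iderive_add_scaled l f g y d d' (-1) fd gd.
rewrite mulN1r (_ : (fun z => _) = (fun z => f z - g z))//.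
by apply/funext => z; rewrite mulN1r.
Qed.

Lemma has_iderive_id l y : has_iderive l id y 1.
Proof.
apply/cvgrPdist_lt => e e0; rewrite !near_withinE; apply: nearW => z /= zy _.
by rewrite divff ?subrr ?normr0// subr_eq0.
Qed.

Lemma has_iderive_opp l f y d : has_iderive l f y d ->
  has_iderive l (fun z => - f z) y (- d).
Proof.
move=> fd; rewrite /has_iderive /diff_quot_lim.
have -> : (fun z => (- f z - - f y) / (z - y)) =
  (fun z => - ((f z - f y) / (z - y))).
  by apply/funext => z; ring.
exact: cvgN.
Qed.

(** Where the derivative is positive, difference quotients are positive nearby.
    All the one-sided first-order conditions below are read off from this,
    at interior points and at endpoints alike. *)
Lemma has_iderive_gt0_near l f y d : has_iderive l f y d -> 0 < d ->
  exists2 eta, 0 < eta & forall z, z \in `[0, l] -> `|z - y| < eta ->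
    (y < z -> f y < f z) /\ (z < y -> f z < f y).
Proof.
move=> /has_iderive_near h d0; have [eta eta0 {}h] := h d d0.
exists eta => // z zl zy.
have q : z != y -> 0 < (f z - f y) / (z - y).
  by move=> zy'; have := h z zl zy' zy; rewrite ltr_norml => /andP[_]; lra.
split=> yz.
  have /q : z != y by rewrite gt_eqF.
  by rewrite pmulr_lgt0 ?subr_gt0// invr_gt0 subr_gt0.
have /q : z != y by rewrite lt_eqF.
by rewrite nmulr_lgt0 ?invr_lt0 ?subr_lt0.
Qed.

Lemma has_iderive_right_max l f y d b : 0 <= y -> y < b -> b <= l ->
  has_iderive l f y d -> (forall z, z \in `[y, b] -> f z <= f y) -> d <= 0.
Proof.
move=> y0 yb bl fd fy; rewrite leNgt; apply/negP => d0.
have [eta eta0 h] := has_iderive_gt0_near fd d0.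
have [z [yz zb zeta]] : exists z, [/\ y < z, z <= b & z - y < eta].
  exists (Num.min b (y + eta / 2)); split.
  - by rewrite lt_min yb ltrDl divr_gt0.
  - by rewrite ge_min lexx.
  - by rewrite ltrBlDl gt_min; apply/orP; right; lra.
have [||/(_ yz)+ _] := h z.
- by rewrite in_itv /=; apply/andP; split; lra.
- by rewrite gtr0_norm// subr_gt0.
by apply/negP; rewrite -leNgt; apply: fy; rewrite in_itv /= (ltW yz).
Qed.

Lemma has_iderive_left_max l f y d a : 0 <= a -> a < y -> y <= l ->
  has_iderive l f y d -> (forall z, z \in `[a, y] -> f z <= f y) -> 0 <= d.
Proof.
move=> a0 ay yl fd fy; rewrite leNgt; apply/negP => d0.
have [|eta eta0 h] := has_iderive_gt0_near (has_iderive_opp fd).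
  by rewrite oppr_gt0.
have [z [az zy zeta]] : exists z, [/\ a <= z, z < y & y - z < eta].
  exists (Num.max a (y - eta / 2)); split.
  - by rewrite le_max lexx.
  - by rewrite gt_max ay /=; lra.
  - by rewrite ltrBlDr -ltrBlDl lt_max; apply/orP; right; lra.
have [||_ /(_ zy)] := h z.
- by rewrite in_itv /=; apply/andP; split; lra.
- by rewrite distrC gtr0_norm// subr_gt0.
by rewrite ltrN2; apply/negP; rewrite -leNgt; apply: fy; rewrite in_itv /= az ltW.
Qed.

Lemma has_iderive_right_min l f y d b : 0 <= y -> y < b -> b <= l ->
  has_iderive l f y d -> (forall z, z \in `[y, b] -> f y <= f z) -> 0 <= d.
Proof.
move=> y0 yb bl /has_iderive_opp fd fy; rewrite -oppr_le0.
by apply: has_iderive_right_max y0 yb bl fd _ => z /fy; rewrite lerN2.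
Qed.

Lemma has_iderive_left_min l f y d a : 0 <= a -> a < y -> y <= l ->
  has_iderive l f y d -> (forall z, z \in `[a, y] -> f y <= f z) -> d <= 0.
Proof.
move=> a0 ay yl /has_iderive_opp fd fy; rewrite -oppr_ge0.
by apply: has_iderive_left_max a0 ay yl fd _ => z /fy; rewrite lerN2.
Qed.

(** A maximum point m of v on [y, z] has v m >= v y >= P, so v1 m > 0; but at a
    maximum point to the left of z the derivative is nonpositive. Hence m =
    z. For v a first derivative, this says that once a slope is steep it
    stays steep and grows. *)
Lemma nondecreasing_above_level l v v1 P y z :
  (forall t, t \in `[0, l] -> has_iderive l v t (v1 t)) ->
  (forall t, t \in `[0, l] -> P <= v t -> 0 < v1 t) ->
  0 <= y -> y <= z -> z <= l -> P <= v y -> v y <= v z.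
Proof.
move=> dv pos y0 yz zl Py.
have [m + mmax] := EVT_max yz (within_continuous_iderive y0 zl dv).
rewrite in_itv /= => /andP[ym mz].
have yin : y \in `[y, z] by rewrite in_itv /= lexx.
have [mz'|] := ltP m z; last first.
  by move=> zm; rewrite (@le_anti _ _ z m) ?zm ?mz//; exact: mmax.
have ml : m \in `[0, l] by rewrite in_itv /=; apply/andP; split; lra.
have := pos m ml (le_trans Py (mmax y yin)).
have : v1 m <= 0.
  apply: has_iderive_right_max (le_trans y0 ym) mz' zl (dv m ml) _.
  move=> t; rewrite in_itv /= => /andP[mt tz].
  by apply: mmax; rewrite in_itv /= tz (le_trans ym mt).
by move=> /le_lt_trans h /h; rewrite ltxx.
Qed.

(** The mirror image of the previous lemma: a minimum point of v on [y, z] to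
    the right of y would have a nonpositive derivative. *)
Lemma nondecreasing_below_level l v v1 P y z :
  (forall t, t \in `[0, l] -> has_iderive l v t (v1 t)) ->
  (forall t, t \in `[0, l] -> v t <= P -> 0 < v1 t) ->
  0 <= y -> y <= z -> z <= l -> v z <= P -> v y <= v z.
Proof.
move=> dv pos y0 yz zl Pz.
have [m + mmin] := EVT_min yz (within_continuous_iderive y0 zl dv).
rewrite in_itv /= => /andP[ym mz].
have zin : z \in `[y, z] by rewrite in_itv /= lexx yz.
have [ym'|] := ltP y m; last first.
  by move=> my; rewrite (@le_anti _ _ y m) ?ym ?my//; exact: mmin.
have ml : m \in `[0, l] by rewrite in_itv /=; apply/andP; split; lra.
have := pos m ml (le_trans (mmin z zin) Pz).
have : v1 m <= 0.
  apply: has_iderive_left_min y0 ym' (le_trans mz zl) (dv m ml) _.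
  move=> t; rewrite in_itv /= => /andP[yt tm].
  by apply: mmin; rewrite in_itv /= yt (le_trans tm mz).
by move=> /le_lt_trans h /h; rewrite ltxx.
Qed.

(** Subtracting the linear function of slope c leaves a function with positive
    derivative, to which the level criterion applies at every level. *)
Lemma iderive_gt_mean l v v1 c y z :
  (forall t, t \in `[0, l] -> has_iderive l v t (v1 t)) ->
  (forall t, t \in `[0, l] -> c < v1 t) ->
  0 <= y -> y <= z -> z <= l -> v y + c * (z - y) <= v z.
Proof.
move=> dv cv y0 yz zl.
have dw t : t \in `[0, l] ->
    has_iderive l (fun s => v s + - c * id s) t (v1 t + - c * 1).
  by move=> tl; apply: has_iderive_add_scaled; [exact: dv|exact: has_iderive_id].
have pos t : t \in `[0, l] -> v y + - c * y <= v t + - c * t ->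
    0 < v1 t + - c * 1.
  by move=> /cv; lra.
have := nondecreasing_above_level dw pos y0 yz zl (lexx _); rewrite /=; lra.
Qed.

Lemma lipschitz_of_iderive l v v1 L :
  (forall t, t \in `[0, l] -> has_iderive l v t (v1 t)) ->
  (forall t, t \in `[0, l] -> `|v1 t| <= L) ->
  forall y z, y \in `[0, l] -> z \in `[0, l] -> `|v y - v z| <= L * `|y - z|.
Proof.
move=> dv Lv.
(* The strict inequality needed above forces a slack; it is chosen so that its
   contribution over [y, z] is below e. *)
have one_sided (f f1 : R -> R) y z :
    (forall t, t \in `[0, l] -> has_iderive l f t (f1 t)) ->
    (forall t, t \in `[0, l] -> - L <= f1 t) ->
    0 <= y -> y <= z -> z <= l -> f y - f z <= L * (z - y).
  move=> df Lf y0 yz zl; apply/ler_addgt0Pr => e e0.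
  have c0 : 0 < z - y + 1 by lra.
  have k0 : 0 < e / (z - y + 1) by rewrite divr_gt0.
  have h t : t \in `[0, l] -> - L - e / (z - y + 1) < f1 t.
    by move=> /Lf; lra.
  have := iderive_gt_mean df h y0 yz zl.
  have : e / (z - y + 1) * (z - y) <= e.
    have ee : e / (z - y + 1) * (z - y + 1) = e by rewrite divfK// gt_eqF.
    by rewrite -[leRHS]ee ler_wpM2l; lra.
  by rewrite mulrBl mulNr; lra.
have ordered y z : 0 <= y -> y <= z -> z <= l -> `|v y - v z| <= L * (z - y).
  move=> y0 yz zl; rewrite ler_norml; apply/andP; split.
    have := @one_sided (fun s => - v s) (fun s => - v1 s) y z.
    move=> /(_ _ _ y0 yz zl) h.
    suff : - v y - - v z <= L * (z - y) by lra.
    apply: h => t tl; first exact: has_iderive_opp (dv t tl).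
    by have := Lv t tl; rewrite ler_norml => /andP[]; lra.
  by apply: one_sided dv _ y0 yz zl => t /Lv; rewrite ler_norml => /andP[].
move=> y z; rewrite !in_itv /= => /andP[y0 yl] /andP[z0 zl].
have [yz|zy] := leP y z.
  by rewrite (distrC y z) (ger0_norm (_ : 0 <= z - y)) ?subr_ge0//; exact: ordered.
rewrite distrC (ger0_norm (_ : 0 <= y - z)) ?subr_ge0 ?(ltW zy)//.
by apply: ordered => //; exact: ltW.
Qed.

(** Minimality gives w y <= w b, and w is decreasing, so the largest value on
    [y, b] cannot be attained anywhere: not at a point to the right of y by
    the sign of the derivative there, and not at y, since b would then be a
    maximum point as well. *)
Lemma decreasing_right_not_min l w w1 y b : 0 <= y -> y < b -> b <= l ->
  (forall t, t \in `[0, l] -> has_iderive l w t (w1 t)) ->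
  (forall t, y < t -> t <= b -> w1 t < 0) ->
  ~ (forall t, t \in `[y, b] -> w y <= w t).
Proof.
move=> y0 yb bl dw neg wmin.
have nomax m : y < m -> m <= b -> ~ (forall t, t \in `[y, b] -> w t <= w m).
  move=> ym mb mmax; have := neg m ym mb; apply/negP; rewrite -leNgt.
  apply: (@has_iderive_left_max l w m _ y) => //; first exact: le_trans bl.
    by apply: dw; rewrite in_itv /=; apply/andP; split; lra.
  move=> t; rewrite in_itv /= => /andP[yt tm]; apply: mmax.
  by rewrite in_itv /= yt (le_trans tm mb).
have [m + mmax] := EVT_max (ltW yb) (within_continuous_iderive y0 bl dw).
rewrite in_itv /= => /andP[+ mb]; rewrite le_eqVlt => /orP[/eqP ym|ym].
  apply: (nomax b yb (lexx _)) => t /mmax; rewrite -ym => /le_trans; apply.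
  by apply: wmin; rewrite in_itv /= lexx ltW.
exact: nomax ym mb mmax.
Qed.

Lemma increasing_left_not_min l w w1 y a : 0 <= a -> a < y -> y <= l ->
  (forall t, t \in `[0, l] -> has_iderive l w t (w1 t)) ->
  (forall t, a <= t -> t < y -> 0 < w1 t) ->
  ~ (forall t, t \in `[a, y] -> w y <= w t).
Proof.
move=> a0 ay yl dw pos wmin.
have nomax m : a <= m -> m < y -> ~ (forall t, t \in `[a, y] -> w t <= w m).
  move=> am my mmax; have := pos m am my; apply/negP; rewrite -leNgt.
  apply: (@has_iderive_right_max l w m _ y) => //; first exact: le_trans am.
    by apply: dw; rewrite in_itv /=; apply/andP; split; lra.
  move=> t; rewrite in_itv /= => /andP[mt ty]; apply: mmax.
  by rewrite in_itv /= ty (le_trans am mt).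
have [m + mmax] := EVT_max (ltW ay) (within_continuous_iderive a0 yl dw).
rewrite in_itv /= => /andP[am]; rewrite le_eqVlt => /orP[/eqP my|my].
  apply: (nomax a (lexx _) ay) => t /mmax; rewrite my => /le_trans; apply.
  by apply: wmin; rewrite in_itv /= lexx ltW.
exact: nomax am my mmax.
Qed.

(** With w1 y = 0 and d < 0, the derivative w1 is negative just to the right of
    y and positive just to its left. The proof uses whichever side lies in
    [0, l], so the test is valid at an endpoint provided that the first
    derivative vanishes there. *)
Lemma second_derivative_test l w w1 y d : 0 < l -> y \in `[0, l] ->
  (forall t, t \in `[0, l] -> has_iderive l w t (w1 t)) ->
  has_iderive l w1 y d -> w1 y = 0 ->
  (forall t, t \in `[0, l] -> w y <= w t) -> 0 <= d.
Proof.
move=> l0 + dw dw1 w1y wmin; rewrite in_itv /= => /andP[y0 yl].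
rewrite leNgt; apply/negP => d0.
have [|eta eta0 h] := has_iderive_gt0_near (has_iderive_opp dw1).
  by rewrite oppr_gt0.
have [ylt|ly] := ltP y l.
  pose b := Num.min l (y + eta / 2).
  have yb : y < b by rewrite lt_min ylt ltrDl divr_gt0.
  have bl : b <= l by rewrite ge_min lexx.
  have beta : b - y < eta by rewrite ltrBlDl gt_min; apply/orP; right; lra.
  apply: (decreasing_right_not_min y0 yb bl dw) => t; last first.
    rewrite in_itv /= => /andP[yt tb].
    by apply: wmin; rewrite in_itv /=; apply/andP; split; lra.
  move=> yt tb; have [||/(_ yt)] := h t.
  - by rewrite in_itv /=; apply/andP; split; lra.
  - by rewrite gtr0_norm ?subr_gt0//; lra.
  - by rewrite w1y; lra.
have y_gt0 : 0 < y by lra.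
pose a := Num.max 0 (y - eta / 2).
have ay : a < y by rewrite gt_max y_gt0 /=; lra.
have a0 : 0 <= a by rewrite le_max lexx.
have aeta : y - a < eta.
  by rewrite ltrBlDr -ltrBlDl lt_max; apply/orP; right; lra.
apply: (increasing_left_not_min a0 ay yl dw) => t; last first.
  rewrite in_itv /= => /andP[at_ ty].
  by apply: wmin; rewrite in_itv /=; apply/andP; split; lra.
move=> at_ ty; have [||_ /(_ ty)] := h t.
- by rewrite in_itv /=; apply/andP; split; lra.
- by rewrite distrC gtr0_norm ?subr_gt0//; lra.
- by rewrite w1y; lra.
Qed.

(** Every point of the closed interval is a limit of interior points. *)
Lemma le_on_closed_interval l f c : 0 < l -> {within `[0, l], continuous f} ->
  (forall y, y \in `]0, l[ -> f y <= c) -> forall y, y \in `[0, l] -> f y <= c.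
Proof.
move=> l0 /subspace_continuousP cf fc y yl; rewrite leNgt; apply/negP => cfy.
have := cf y yl; move/cvgrPdist_lt => /(_ (f y - c)); rewrite subr_gt0 => /(_ cfy).
rewrite near_withinE => /nbhs_ballP[eta /= eta0 h].
move: (yl); rewrite in_itv /= => /andP[y0 y_l].
have [z [z0 zl zy]] : exists z, [/\ 0 < z, z < l & `|y - z| < eta].
  have [y2|y2] := leP y (l / 2).
    exists (y + Num.min (l / 4) (eta / 2)); rewrite opprD addNKr normrN.
    have m0 : 0 < Num.min (l / 4) (eta / 2) by rewrite lt_min !divr_gt0.
    rewrite gtr0_norm// gt_min; split; first lra.
      by rewrite -ltrBrDl gt_min; apply/orP; left; lra.
    by apply/orP; right; lra.
  exists (y - Num.min (l / 4) (eta / 2)); rewrite (subKr y).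
  have m0 : 0 < Num.min (l / 4) (eta / 2) by rewrite lt_min !divr_gt0.
  rewrite gtr0_norm// gt_min; split; last by apply/orP; right; lra.
    by rewrite subr_gt0 gt_min; apply/orP; left; lra.
  by lra.
have := h z zy; rewrite /= in_itv /= (ltW z0) (ltW zl) => /(_ isT).
have := fc z; rewrite in_itv /= z0 zl => /(_ isT) fz.
by rewrite ltr_norml => /andP[_]; rewrite ltrD2l ltrN2 ltNge fz.
Qed.

End IntervalDerivative.

(** * Uniform bounds *)

Lemma fin_upper_bound (R : realType) (T : finType) (Q : T -> R -> Prop) :
  (forall t a b, a <= b -> Q t a -> Q t b) -> (forall t, exists a, Q t a) ->
  exists2 a, 0 < a & forall t, Q t a.
Proof.
move=> Qup /choice[f Qf]; exists (1 + \sum_t `|f t|).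
  by rewrite ltr_pwDl// sumr_ge0.
move=> t; apply: Qup (Qf t); rewrite (bigD1 t)//=.
apply: le_trans (ler_norm _) _.
by rewrite addrA [1 + _]addrC -addrA lerDl addr_ge0// sumr_ge0.
Qed.

Lemma within_continuous_bounded (R : realType) (l : R) (f : R -> R) : 0 < l ->
  {within `[0, l], continuous f} ->
  exists a, forall y, y \in `[0, l] -> `|f y| <= a.
Proof.
move=> l0 cf.
have [x _ xmax] := EVT_max (ltW l0) cf.
have [z _ zmin] := EVT_min (ltW l0) cf.
exists (`|f x| + `|f z|) => y yl; rewrite ler_norml; apply/andP; split.
  have := zmin y yl; have := normr_ge0 (f x).
  by have := ler_norm (- f z); rewrite normrN; lra.
have := xmax y yl; have := normr_ge0 (f z).
by have := ler_norm (f x); lra.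
Qed.

(** * Vertices and ends of edges *)

Section NetworkEnds.
Context {R : realType} {n : nat} (G : network_data R n).
Hypothesis netG : topological_network G.
Implicit Types (i : vertex G) (j : edge G) (u psi : 'rV[R]_n -> R).

Lemma start_in j : 0 \in `[0, len j].
Proof. by rewrite in_itv /= lexx ltW// net_len_gt0. Qed.

Lemma end_in j : len j \in `[0, len j].
Proof. by rewrite in_itv /= lexx ltW// net_len_gt0. Qed.

Lemma curveK j t : t \in `[0, len j] -> param j (curve j t) = t.
Proof.
move=> tl; rewrite /param.
have [sl st] := @xgetPex _ 0
  [set s | s \in `[0, len j] /\ curve j s = curve j t]
  (ex_intro _ t (conj tl erefl)).
exact: (net_simple netG) st.
Qed.

Lemma start_neq_end j : curve j 0 != curve j (len j).
Proof.
apply/eqP => /(net_simple netG (start_in j) (end_in j)) e.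
by have := net_len_gt0 netG j; rewrite -e ltxx.
Qed.

(** The two ends of the edge are distinct vertices on it, and there are only two
    vertices on the closed edge, so a third one is excluded. *)
Lemma Inc_ends i j : j \in Inc i ->
  pos i = curve j 0 \/ pos i = curve j (len j).
Proof.
rewrite inE => /set_mem pe.
have [v0 vl] := net_ends netG j.
have : (closed_edge j `&` vertices G #<= `I_2)%card.
  by have := net_two_vertices netG j; rewrite card_eq_le => /andP[].
move=> /pcard_leP[f].
have a0 : (closed_edge j `&` vertices G) (curve j 0).
  by split=> //; exists 0 => //; exact: start_in.
have al : (closed_edge j `&` vertices G) (curve j (len j)).
  by split=> //; exists (len j) => //; exact: end_in.
have ai : (closed_edge j `&` vertices G) (pos i) by split=> //; exists i.
have inj x y : (closed_edge j `&` vertices G) x ->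
    (closed_edge j `&` vertices G) y -> f x = f y -> x = y.
  by move=> xA yA; apply: 'inj_f; rewrite inE.
have fI x : (closed_edge j `&` vertices G) x -> (f x < 2)%N.
  by move=> xA; have := 'funS_f xA.
have [|n0] := eqVneq (f (pos i)) (f (curve j 0)); first by left; exact: inj.
have [|nl] := eqVneq (f (pos i)) (f (curve j (len j))); first by right; exact: inj.
have n0l : f (curve j 0) != f (curve j (len j)).
  by apply: contra (start_neq_end j) => /eqP/inj ->.
move: (fI _ a0) (fI _ al) (fI _ ai) n0 nl n0l.
by case: (f (pos i)) => [|[|?]]; case: (f (curve j 0)) => [|[|?]];
   case: (f (curve j (len j))) => [|[|?]].
Qed.

Lemma start_Inc i j : pos i = curve j 0 -> j \in Inc i.
Proof. by move=> e; rewrite inE; apply/mem_set; exists 0; rewrite ?e//; exact: start_in. Qed.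

Lemma end_Inc i j : pos i = curve j (len j) -> j \in Inc i.
Proof.
by move=> e; rewrite inE; apply/mem_set; exists (len j); rewrite ?e//; exact: end_in.
Qed.

Lemma start_vertex j : exists i, pos i = curve j 0.
Proof. by have [[i _ e] _] := net_ends netG j; exists i. Qed.

Lemma end_vertex j : exists i, pos i = curve j (len j).
Proof. by have [_ [i _ e]] := net_ends netG j; exists i. Qed.

Definition edge_deriv u j : R -> R := iderive (len j) (on_edge u j).

Definition edge_deriv2 u j : R -> R := iderive (len j) (edge_deriv u j).

(** The derivative at the vertex in the direction that enters the edge: the
    signed incidence turns the parameter direction around at the far end. *)
Definition inward_deriv u i j : R := signed_incidence i j * pderive 1 j u (pos i).

Lemma inward_start u i j : pos i = curve j 0 ->
  inward_deriv u i j = edge_deriv u j 0.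
Proof.
move=> e; rewrite /inward_deriv /signed_incidence /pderive e eqxx mul1r.
by rewrite curveK//; exact: start_in.
Qed.

Lemma inward_end u i j : pos i = curve j (len j) ->
  inward_deriv u i j = - edge_deriv u j (len j).
Proof.
move=> e; rewrite /inward_deriv /signed_incidence /pderive e eqxx.
by rewrite (negbTE (start_neq_end j)) mulN1r curveK//; exact: end_in.
Qed.

Lemma kirchhoffE beta i u :
  kirchhoff beta i u = \sum_(j in Inc i) beta i j * inward_deriv u i j.
Proof. by apply: eq_bigr => j _; rewrite mulrA. Qed.

Lemma Ck_net_iderive u j y : Ck_net G 2 u -> y \in `[0, len j] ->
  has_iderive (len j) (on_edge u j) y (edge_deriv u j y).
Proof. by move=> [_ /(_ j)[d _]] yl; exact: (d 0%N). Qed.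

Lemma Ck_net_iderive2 u j y : Ck_net G 2 u -> y \in `[0, len j] ->
  has_iderive (len j) (edge_deriv u j) y (edge_deriv2 u j y).
Proof. by move=> [_ /(_ j)[d _]] yl; exact: (d 1%N). Qed.

Lemma on_edge_continuous u j : Ck_net G 2 u ->
  {within `[0, len j], continuous (on_edge u j)}.
Proof. by move=> [_ /(_ j)[_ c]]; exact: (c 0%N). Qed.

Lemma edge_deriv_continuous u j : Ck_net G 2 u ->
  {within `[0, len j], continuous (edge_deriv u j)}.
Proof. by move=> [_ /(_ j)[_ c]]; exact: (c 1%N). Qed.

Lemma edge_deriv2_continuous u j : Ck_net G 2 u ->
  {within `[0, len j], continuous (edge_deriv2 u j)}.
Proof. by move=> [_ /(_ j)[_ c]]; exact: (c 2%N). Qed.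

(** From a minimum point of u - psi, this difference cannot decrease into the
    edge. *)
Lemma inward_deriv_le_at_min u psi i j : Ck_net G 2 u -> Ck_net G 2 psi ->
  j \in Inc i ->
  (forall y, y \in `[0, len j] ->
     u (pos i) - psi (pos i) <= u (curve j y) - psi (curve j y)) ->
  inward_deriv psi i j <= inward_deriv u i j.
Proof.
move=> u2 psi2 ji minw; have l0 := net_len_gt0 netG j.
have dw y (yl : y \in `[0, len j]) :=
  has_iderive_sub (Ck_net_iderive u2 yl) (Ck_net_iderive psi2 yl).
have [e|e] := Inc_ends ji.
  rewrite !inward_start// -subr_ge0.
  apply: has_iderive_right_min (lexx 0) l0 (lexx _) (dw _ (start_in j)) _.
  by move=> y /minw; rewrite e.
rewrite !inward_end// lerN2 -subr_le0.
apply: has_iderive_left_min (lexx 0) l0 (lexx _) (dw _ (end_in j)) _.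
by move=> y /minw; rewrite e.
Qed.

End NetworkEnds.

(** * The lower barrier *)

Section Comparison.
Context {R : realType} {n : nat} (G : network_data R n).
Hypothesis netG : topological_network G.
Variables (IB : {set vertex G}) (beta : vertex G -> edge G -> R).
Hypothesis beta_gt0 : forall i j, i \notin IB -> j \in Inc i -> 0 < beta i j.
Variable H : hamiltonian G.
Implicit Types (i : vertex G) (j : edge G) (u psi : 'rV[R]_n -> R).

Lemma hamiltonian_along_edge_continuous j (f f1 : R -> R) :
  {within [set z : R * R * R | z.1.1 \in `[0, len j]],
     continuous (fun z : R * R * R => H j z.1.1 z.1.2 z.2)} ->
  {within `[0, len j], continuous f} -> {within `[0, len j], continuous f1} ->
  {within `[0, len j], continuous (fun y => H j y (f y) (f1 y))}.
Proof.
move=> /subspace_continuousP cH /subspace_continuousP cf /subspace_continuousP cf1.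
apply/subspace_continuousP => y yl.
apply: (@cvg_comp _ _ _ (fun y => (y, f y, f1 y))
  (fun z : R * R * R => H j z.1.1 z.1.2 z.2) _ _ _ _ (cH (y, f y, f1 y) yl)).
have cid : z @[z --> within `[0, len j] (nbhs y)] --> y.
  by apply: cvg_within_filter; exact: cvg_id.
move=> A WA.
have : nbhs y (fun z => z \in `[0, len j] -> z \in `[0, len j] -> A (z, f z, f1 z)).
  exact: (cvg_pair (cvg_pair cid (cf y yl)) (cf1 y yl) WA).
by apply: filterS => z h zl; exact: h.
Qed.

(** The left-hand side of the equation, in the parameter of the edge. *)
Definition residual (eps : R) u j (y : R) : R :=
  - eps * edge_deriv2 u j y + H j y (on_edge u j y) (edge_deriv u j y).

Hypothesis H_cont : forall j, {within [set z : R * R * R | z.1.1 \in `[0, len j]],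
  continuous (fun z : R * R * R => H j z.1.1 z.1.2 z.2)}.

Lemma residual_continuous eps u j : Ck_net G 2 u ->
  {within `[0, len j], continuous (residual eps u j)}.
Proof.
move=> u2.
have /subspace_continuousP c1 := hamiltonian_along_edge_continuous (H_cont (j := j))
  (on_edge_continuous (j := j) u2) (edge_deriv_continuous (j := j) u2).
have /subspace_continuousP c2 := edge_deriv2_continuous (j := j) u2.
apply/subspace_continuousP => y yl; apply: cvgD; last exact: c1.
by apply: cvgM; [exact: cvg_cst|exact: c2].
Qed.

Lemma residualE eps u j (y : R) : y \in `[0, len j] ->
  - eps * pderive 2 j u (curve j y) + hamiltonian_at H j u (curve j y) =
  residual eps u j y.
Proof. by move=> yl; rewrite /hamiltonian_at /pderive curveK. Qed.

Lemma residual_le eps u (c : R) : Ck_net G 2 u ->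
  (forall j x, open_edge j x ->
     - eps * pderive 2 j u x + hamiltonian_at H j u x <= c) ->
  forall j y, y \in `[0, len j] -> residual eps u j y <= c.
Proof.
move=> u2 hc j; apply: (le_on_closed_interval (net_len_gt0 netG j)).
  exact: residual_continuous.
move=> y y0l; rewrite -residualE; last exact: subset_itv_oo_cc.
by apply: hc; exists y.
Qed.

(** The equation is assumed in the open edges only; by continuity of all its
    terms it persists at the vertices, where the barrier argument needs it. *)
Lemma residual_eq0 eps u : Ck_net G 2 u ->
  (forall j x, open_edge j x ->
     - eps * pderive 2 j u x + hamiltonian_at H j u x = 0) ->
  forall j y, y \in `[0, len j] -> residual eps u j y = 0.
Proof.
move=> u2 ode j y yl; apply: le_anti; apply/andP; split.
  by apply: residual_le yl => // k x /ode ->.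
rewrite -oppr_le0; move: y yl.
apply: (le_on_closed_interval (net_len_gt0 netG j)) => [|y y0l].
  have /subspace_continuousP c := @residual_continuous eps u j u2.
  by apply/subspace_continuousP => y yl; apply: cvgN; exact: c.
rewrite -residualE ?ode ?oppr0//; last exact: subset_itv_oo_cc.
by exists y.
Qed.

(** The differences of the inward derivatives are all nonnegative at a minimum
    vertex of u - psi, while their sum with the positive weights beta is
    nonpositive by the Kirchhoff conditions. So each of them vanishes. *)
Lemma inward_eq_at_min u psi i : Ck_net G 2 u -> Ck_net G 2 psi ->
  i \notin IB -> kirchhoff beta i u <= kirchhoff beta i psi ->
  (forall j y, y \in `[0, len j] ->
     u (pos i) - psi (pos i) <= u (curve j y) - psi (curve j y)) ->
  forall j, j \in Inc i -> inward_deriv u i j = inward_deriv psi i j.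
Proof.
move=> u2 psi2 iB; rewrite !kirchhoffE -subr_ge0 -sumrB => kle minw j ji.
have ge0 k : k \in Inc i ->
    0 <= beta i k * inward_deriv u i k - beta i k * inward_deriv psi i k.
  move=> ki; rewrite -mulrBr mulr_ge0 ?(ltW (beta_gt0 iB ki))// subr_ge0.
  by apply: inward_deriv_le_at_min => // y; exact: minw.
have s0 : \sum_(k in Inc i)
    (beta i k * inward_deriv u i k - beta i k * inward_deriv psi i k) = 0.
  apply: le_anti; rewrite sumr_ge0// andbT -oppr_ge0 -sumrN.
  by under eq_bigr => k _ do rewrite opprB.
have := psumr_eq0P ge0 s0 ji; rewrite -mulrBr => /eqP.
by rewrite mulf_eq0 gt_eqF ?beta_gt0//= subr_eq0 => /eqP.
Qed.

(** First-order condition at a negative minimum of u - psi over the whole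
    network. The minimum is not at a boundary vertex; at a transition vertex
    the Kirchhoff conditions replace the vanishing of a two-sided
    derivative. *)
Lemma deriv_eq_at_min u psi j (y : R) : Ck_net G 2 u -> Ck_net G 2 psi ->
  (forall i, i \notin IB -> kirchhoff beta i u <= kirchhoff beta i psi) ->
  (forall i, i \in IB -> psi (pos i) <= u (pos i)) ->
  y \in `[0, len j] -> u (curve j y) < psi (curve j y) ->
  (forall (k : edge G) z, z \in `[0, len k] ->
     u (curve j y) - psi (curve j y) <= u (curve k z) - psi (curve k z)) ->
  edge_deriv u j y = edge_deriv psi j y.
Proof.
move=> u2 psi2 kle bd yl neg minw.
have transition i : pos i = curve j y -> i \notin IB.
  by move=> e; apply/negP => /bd; rewrite e leNgt neg.
move: (yl); rewrite in_itv /= => /andP[]; rewrite le_eqVlt => /orP[/eqP y0 _|y0].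
  have [i ie] := start_vertex netG j; rewrite -y0 -!(inward_start netG _ ie).
  rewrite y0 in ie.
  apply: (inward_eq_at_min u2 psi2 (transition i ie) (kle i (transition i ie))).
    by rewrite ie.
  by apply: (start_Inc netG); rewrite y0.
rewrite le_eqVlt => /orP[/eqP ye|ye].
  have [i ie] := end_vertex netG j; apply: oppr_inj.
  rewrite ye -!(inward_end netG _ ie); rewrite -ye in ie.
  apply: (inward_eq_at_min u2 psi2 (transition i ie) (kle i (transition i ie))).
    by rewrite ie.
  by apply: (end_Inc netG); rewrite -ye.
have dw := has_iderive_sub (Ck_net_iderive u2 yl) (Ck_net_iderive psi2 yl).
apply/eqP; rewrite -subr_eq0; apply/eqP; apply: le_anti; apply/andP; split.
  apply: (has_iderive_left_min (lexx 0) y0 (ltW ye) dw) => z.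
  rewrite in_itv /= => /andP[z0 zy].
  by apply: minw; rewrite in_itv /= z0 (le_trans zy (ltW ye)).
apply: (has_iderive_right_min (ltW y0) ye (lexx _) dw) => z.
rewrite in_itv /= => /andP[yz zl].
by apply: minw; rewrite in_itv /= zl (le_trans (ltW y0) yz).
Qed.

(** At a negative minimum of u - psi both first derivatives agree, and u < psi
    together with monotonicity of H in its second argument gives eps * u''
    <= H(y, u, u') <= H(y, psi, psi') < eps * psi''. So the second
    derivative of u - psi is negative there, against the second derivative
    test. Since the equation holds up to the vertices, the same
    contradiction arises at a transition vertex. *)
Lemma comparison_strict_subsolution eps u psi : 0 < eps ->
  Ck_net G 2 u -> Ck_net G 2 psi ->
  (forall j x p, x \in `[0, len j] ->
     {homo (fun r => H j x r p) : r s / r <= s}) ->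
  (forall j y, y \in `[0, len j] ->
    residual eps psi j y < 0) ->
  (forall j y, y \in `[0, len j] ->
    0 <= residual eps u j y) ->
  (forall i, i \notin IB -> kirchhoff beta i u <= kirchhoff beta i psi) ->
  (forall i, i \in IB -> psi (pos i) <= u (pos i)) ->
  forall j y, y \in `[0, len j] -> psi (curve j y) <= u (curve j y).
Proof.
move=> eps0 u2 psi2 Hmono sub sup kle bd j1 y1 y1l.
rewrite leNgt; apply/negP => neg1.
pose w j y := on_edge u j y - on_edge psi j y.
have dw j y (yl : y \in `[0, len j]) :
    has_iderive (len j) (w j) y (edge_deriv u j y - edge_deriv psi j y).
  exact: has_iderive_sub (Ck_net_iderive u2 yl) (Ck_net_iderive psi2 yl).
(* The minimum over the network: minimize on each edge, then over the edges. *)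
have /choice[m mP] : forall j, exists m, m \in `[0, len j] /\
    forall y, y \in `[0, len j] -> w j m <= w j y.
  move=> j; have [m ml mmin] := EVT_min (ltW (net_len_gt0 netG j))
    (within_continuous_iderive (lexx 0) (lexx _) (dw j)).
  by exists m.
pose j0 := [arg min_(j < j1 | true) w j (m j)]%O.
have minw k z : z \in `[0, len k] -> w j0 (m j0) <= w k z.
  move=> zl; apply: le_trans ((mP k).2 z zl); rewrite /j0.
  by case: arg_minP => // j _; apply.
have ml := (mP j0).1.
have neg : u (curve j0 (m j0)) < psi (curve j0 (m j0)).
  rewrite -subr_lt0; apply: le_lt_trans (minw j1 y1 y1l) _.
  by rewrite subr_lt0.
have deq := deriv_eq_at_min u2 psi2 kle bd ml neg minw.
have := second_derivative_test (net_len_gt0 netG j0) ml (dw j0)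
  (has_iderive_sub (Ck_net_iderive2 u2 ml) (Ck_net_iderive2 psi2 ml)).
rewrite deq subrr => /(_ erefl (fun t tl => minw j0 t tl)); apply/negP.
rewrite -ltNge subr_lt0 -(ltr_pM2l eps0).
have := sub j0 _ ml; have := sup j0 _ ml; rewrite /residual deq.
have := Hmono j0 (m j0) (edge_deriv psi j0 (m j0)) ml _ _ (ltW neg).
rewrite /on_edge /=; lra.
Qed.

End Comparison.

(** * The gradient bound *)

Section GradientBound.
Context {R : realType} {n : nat} (G : network_data R n).
Hypothesis netG : topological_network G.
Variables (IB : {set vertex G}) (beta : vertex G -> edge G -> R).
Hypothesis beta_gt0 : forall i j, i \notin IB -> j \in Inc i -> 0 < beta i j.
Implicit Types (i : vertex G) (j : edge G) (u : 'rV[R]_n -> R).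

(** What coercivity leaves of the equation: where the slope is at least P the
    Hamiltonian is positive, hence so is the second derivative. *)
Definition convex_where_steep (P : R) u : Prop :=
  forall j y, y \in `[0, len j] -> P <= `|edge_deriv u j y| ->
    0 < edge_deriv2 u j y.

Lemma steep_increase P u j y z : Ck_net G 2 u -> convex_where_steep P u ->
  0 <= y -> y <= z -> z <= len j -> P <= edge_deriv u j y ->
  edge_deriv u j y <= edge_deriv u j z.
Proof.
move=> u2 cvx; apply: nondecreasing_above_level.
  by move=> t; exact: Ck_net_iderive2.
by move=> t tl Pt; apply: cvx => //; exact: le_trans Pt (ler_norm _).
Qed.

Lemma steep_decrease P u j y z : Ck_net G 2 u -> convex_where_steep P u ->
  0 <= y -> y <= z -> z <= len j -> edge_deriv u j z <= - P ->
  edge_deriv u j y <= edge_deriv u j z.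
Proof.
move=> u2 cvx; apply: nondecreasing_below_level.
  by move=> t; exact: Ck_net_iderive2.
move=> t tl Pt; apply: cvx => //; rewrite -normrN.
by apply: le_trans (ler_norm _); rewrite lerNr.
Qed.

(** Entering the edge with a steep positive slope, a function convex where steep
    only gets steeper; it reaches the other end at a higher value and with
    at least the same slope, which is there outward. *)
Lemma steep_edge_climbs P u i j : Ck_net G 2 u -> convex_where_steep P u ->
  0 < P -> j \in Inc i -> P <= inward_deriv u i j ->
  exists i', [/\ j \in Inc i', inward_deriv u i' j <= - inward_deriv u i j &
    u (pos i) < u (pos i')].
Proof.
move=> u2 cvx P0 ji; have l0 := net_len_gt0 netG j.
have [e|e] := Inc_ends netG ji.
  have [i' e'] := end_vertex netG j.
  rewrite (inward_start netG _ e) => Ps; exists i'; split.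
  - exact: end_Inc.
  - rewrite (inward_end netG _ e') lerN2.
    exact: steep_increase u2 cvx (lexx _) (ltW l0) (lexx _) Ps.
  have half t : t \in `[0, len j] -> P / 2 < edge_deriv u j t.
    rewrite in_itv /= => /andP[t0 tl].
    by have := steep_increase u2 cvx (lexx _) t0 tl Ps; lra.
  have := iderive_gt_mean (fun t => @Ck_net_iderive _ _ _ u j t u2) half
    (lexx _) (ltW l0) (lexx _).
  rewrite e e' /on_edge /= => /(lt_le_trans _); apply.
  by rewrite subr0 ltrDl mulr_gt0// divr_gt0.
have [i' e'] := start_vertex netG j.
rewrite (inward_end netG _ e) opprK lerNr => Ps; exists i'; split.
- exact: start_Inc.
- rewrite (inward_start netG _ e').
  exact: steep_decrease u2 cvx (lexx _) (ltW l0) (lexx _) Ps.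
have half t : t \in `[0, len j] -> P / 2 < - edge_deriv u j t.
  rewrite in_itv /= => /andP[t0 tl].
  by have := steep_decrease u2 cvx t0 tl (lexx _) Ps; lra.
have := iderive_gt_mean
  (fun t tl => has_iderive_opp (@Ck_net_iderive _ _ _ u j t u2 tl)) half
  (lexx _) (ltW l0) (lexx _).
rewrite e e' /on_edge /= -subr_ge0 => h; rewrite -subr_gt0.
apply: lt_le_trans (_ : P / 2 * (len j - 0) <= _); last by lra.
by rewrite subr0 mulr_gt0// divr_gt0.
Qed.

(** Kirchhoff's condition balances the weighted slopes: a slope that comes out
    of edge j into the vertex must leave through some edge k, losing at most
    the factor C. If every exit slope were smaller, the weighted sum would
    be negative. *)
Lemma steep_exit C u i j : i \notin IB -> kirchhoff beta i u = 0 ->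
  j \in Inc i -> inward_deriv u i j < 0 -> 0 < C ->
  \sum_(k in Inc i) beta i k <= C * beta i j ->
  exists2 k, k \in Inc i & - inward_deriv u i j <= C * inward_deriv u i k.
Proof.
move=> iB; rewrite kirchhoffE => K0 ji neg C0 Cbeta; apply: contrapT => noexit.
have lt0 k : k \in Inc i ->
    C * (beta i k * inward_deriv u i k) < - inward_deriv u i j * beta i k.
  move=> ki; rewrite mulrCA mulrC ltr_pM2r ?beta_gt0//.
  by rewrite ltNge; apply/negP => h; apply: noexit; exists k.
have : C * (\sum_(k in Inc i) beta i k * inward_deriv u i k) <
    - inward_deriv u i j * (C * beta i j) + C * (beta i j * inward_deriv u i j).
  rewrite (bigD1 j)//= mulrDr addrC ltrD2r mulr_sumr.
  apply: (@le_lt_trans _ _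
    (\sum_(k in Inc i | k != j) - inward_deriv u i j * beta i k)).
    by apply: ler_sum => k /andP[ki _]; exact/ltW/lt0.
  rewrite -mulr_sumr ltr_pM2l ?oppr_gt0//; apply: lt_le_trans Cbeta.
  by rewrite [ltRHS](bigD1 j)//= ltrDr beta_gt0.
by rewrite K0 mulr0; lra.
Qed.

(** A slope arriving at a transition vertex and larger than K * C ^+ m.+1 leaves
    it through another edge with slope larger than K * C ^+ m, is then
    steep, and so climbs to a strictly higher vertex. As values increase
    strictly no vertex is met twice, so the chain ends at a boundary vertex
    after fewer steps than there are vertices, still with a slope larger
    than K: this contradicts the bound at the boundary. The induction is on
    the number of vertices with a higher value of u. *)
Lemma inward_deriv_ge P K C u : 0 < P -> P <= K -> 1 <= C ->
  Ck_net G 2 u -> convex_where_steep P u ->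
  (forall i, i \notin IB -> kirchhoff beta i u = 0) ->
  (forall i j, i \notin IB -> j \in Inc i ->
     \sum_(k in Inc i) beta i k <= C * beta i j) ->
  (forall i j, i \in IB -> j \in Inc i -> - K <= inward_deriv u i j) ->
  forall i j, j \in Inc i ->
    - (K * C ^+ #|vertex G|.+1) <= inward_deriv u i j.
Proof.
move=> P0 PK C1 u2 cvx kir Cbeta bd.
have K0 : 0 < K by exact: lt_le_trans PK.
have C0 : 0 < C by exact: lt_le_trans C1.
pose higher i := [set i' : vertex G | u (pos i) < u (pos i')]%SET.
have bound m : forall i j, (#|higher i| < m)%N -> j \in Inc i ->
    - (K * C ^+ m) <= inward_deriv u i j.
  elim: m => // m IH i j im ji.
  have Cm k : 1 <= C ^+ k by rewrite exprn_ege1.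
  have KCm k : K <= K * C ^+ k by rewrite ler_peMr// ltW.
  have [iB|iB] := boolP (i \in IB).
    by apply: le_trans (bd i j iB ji); rewrite lerN2.
  rewrite leNgt; apply/negP => neg.
  have neg0 : inward_deriv u i j < 0.
    by apply: lt_trans neg _; rewrite oppr_lt0 mulr_gt0// exprn_gt0.
  have [k ki exit] := steep_exit iB (kir i iB) ji neg0 C0 (Cbeta i j iB ji).
  have steep : K * C ^+ m < inward_deriv u i k.
    rewrite -(ltr_pM2l C0); apply: lt_le_trans exit.
    by rewrite mulrCA -exprS ltrNr.
  have [i' [ki' out up]] := steep_edge_climbs u2 cvx P0 ki
    (le_trans PK (le_trans (KCm m) (ltW steep))).
  have fewer : (#|higher i'| < #|higher i|)%N.
    apply: proper_card; apply/properP; split.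
      by apply/fintype.subsetP => v; rewrite !inE; exact: lt_trans.
    by exists i'; rewrite inE// ltxx.
  have := IH i' k (leq_trans fewer im) ki'; apply/negP; rewrite -ltNge.
  by apply: le_lt_trans out _; rewrite ltrN2.
move=> i j ji; apply: bound => //.
by rewrite ltnS max_card.
Qed.

(** By persistence, a steep slope inside an edge is dominated by the slope with
    which u leaves the edge at one of its ends. *)
Lemma edge_deriv_bound P L u : Ck_net G 2 u -> convex_where_steep P u ->
  P <= L -> (forall i j, j \in Inc i -> - L <= inward_deriv u i j) ->
  forall j y, y \in `[0, len j] -> `|edge_deriv u j y| <= L.
Proof.
move=> u2 cvx PL ends j y yl; have := yl; rewrite in_itv /= => /andP[y0 y_l].
have l0 := net_len_gt0 netG j.
rewrite ler_norml; apply/andP; split; rewrite leNgt; apply/negP => h.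
  have [i e] := start_vertex netG j.
  have := ends i j (start_Inc netG e); rewrite (inward_start netG _ e).
  have : edge_deriv u j y <= - P by lra.
  by move=> /(steep_decrease u2 cvx (lexx _) y0 y_l); lra.
have [i e] := end_vertex netG j.
have := ends i j (end_Inc netG e); rewrite (inward_end netG _ e).
have : P <= edge_deriv u j y by lra.
by move=> /(steep_increase u2 cvx y0 y_l (lexx _)); lra.
Qed.

End GradientBound.

(** * Walks and the path distance *)

Section PathDistance.
Context {R : realType} {n : nat} (G : network_data R n).
Hypothesis netG : topological_network G.
Implicit Types (x y z : 'rV[R]_n) (i : vertex G) (j : edge G)
  (u : 'rV[R]_n -> R).

Lemma walk_length_trans x y z r s : walk_length G x y r ->
  walk_length G y z s -> walk_length G x z (r + s).
Proof.
elim=> [a _|j a b y' r' al bl _ IH] yz; first by rewrite add0r.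
by rewrite -addrA; apply: walk_step => //; exact: IH.
Qed.

Lemma walk_along_edge j (s t : R) : s \in `[0, len j] -> t \in `[0, len j] ->
  walk_length G (curve j s) (curve j t) `|s - t|.
Proof.
move=> sl tl; rewrite -[`|_|]addr0; apply: walk_step => //.
by apply: walk_refl; exists j => //; exists t.
Qed.

Lemma walk_between_vertices i i' : Gamma G (pos i) ->
  exists r, walk_length G (pos i) (pos i') r.
Proof.
have /connectP[p pp ->] := net_connected netG i i'.
elim: p i pp => [|k p IH] i /=.
  by move=> _ Gi; exists 0; exact: walk_refl.
move=> /andP[/existsP[j /andP[ji jk]] pp] _.
have [s sl si] : closed_edge j (pos i) by move: ji; rewrite inE => /set_mem.
have [t tl tk] : closed_edge j (pos k) by move: jk; rewrite inE => /set_mem.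
have Gk : Gamma G (pos k) by exists j => //; exists t.
have [r kr] := IH k pp Gk; exists (`|s - t| + r).
by rewrite -si; apply: walk_step => //; rewrite tk.
Qed.

Lemma walk_exists x y : Gamma G x -> Gamma G y -> exists r, walk_length G x y r.
Proof.
move=> [j _ [s sl <-]] [j' _ [s' sl' <-]].
have [i e] := start_vertex netG j; have [i' e'] := start_vertex netG j'.
have Gi : Gamma G (pos i).
  by exists j => //; exists 0; rewrite ?e//; exact: (start_in netG).
have [r ii'] := walk_between_vertices i' Gi.
exists (`|s - 0| + (r + `|0 - s'|)); apply: walk_length_trans.
  by apply: walk_along_edge => //; exact: (start_in netG).
rewrite -e; apply: walk_length_trans ii' _; rewrite e'.
by apply: walk_along_edge => //; exact: (start_in netG).
Qed.

(** Edgewise estimates add up along each walk, so they pass to the infimum of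
    the lengths; connectedness ensures that this infimum is over a nonempty
    set. *)
Lemma net_lipschitz_of_edges (L : R) u : 0 < L ->
  (forall j s t, s \in `[0, len j] -> t \in `[0, len j] ->
     `|u (curve j s) - u (curve j t)| <= L * `|s - t|) ->
  net_lipschitz G L u.
Proof.
move=> L0 edges x y Gx Gy; rewrite mulrC -ler_pdivrMr//.
apply: lb_le_inf; first by have [r xy] := walk_exists Gx Gy; exists r.
move=> r /= xy; rewrite ler_pdivrMr// mulrC.
elim: xy => [a _|j s t b r' sl tl _ IH]; first by rewrite subrr normr0 mulr0.
rewrite mulrDr -(subrKA (u (curve j t))).
by apply: le_trans (ler_normD _ _) _; apply: lerD => //; exact: edges.
Qed.

End PathDistance.

(** * Uniform estimates for the viscous solutions *)

Theorem theorem4p1 (R : realType) (n : nat) (G : network_data R n)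
  (IB : {set vertex G}) (beta : vertex G -> edge G -> R) (g : vertex G -> R)
  (H : hamiltonian G) (delta : R) (psi : 'rV[R]_n -> R)
  (u : R -> 'rV[R]_n -> R)
  (netG : topological_network G)
  (bdIB : boundary_indices IB)
  (beta_gt0 : forall i j, i \notin IB -> j \in Inc i -> 0 < beta i j)
  (H_cont : forall j, {within [set z : R * R * R | z.1.1 \in `[0, len j]],
     continuous (fun z : R * R * R => H j z.1.1 z.1.2 z.2)})
  (H_mono : forall j x p, x \in `[0, len j] ->
     {homo (fun r => H j x r p) : r s / r <= s})
  (H_vertex : forall i j r, i \notin IB -> j \in Inc i ->
     {in `]0, +oo[ &, {homo H j (param j (pos i)) r : p q / p <= q}})
  (H_coercive : forall (A : R) j, 0 < A -> forall M : R, exists P : R,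
     forall x r p, x \in `[0, len j] -> r \in `[- A, A] -> P <= `|p| -> M <= H j x r p)
  (H_alt :
     [\/ forall j x, x \in `]0, len j[ -> C1_plane (fun z : R * R => H j x z.1 z.2),
         forall j y p, y \in `[0, len j] -> {homo (fun r => H j y r p) : r s / r < s} |
         exists K : R, forall j x r s p q, x \in `[0, len j] ->
           `|H j x r p - H j x s q| <= K * (`|r - s| + `|p - q|)])
  (delta_gt0 : 0 < delta)
  (psi_C2 : Ck_net G 2 psi)
  (psi_sub : forall j x, open_edge j x -> hamiltonian_at H j psi x <= - delta)
  (psi_transition : forall i, i \notin IB -> 0 <= kirchhoff beta i psi)
  (psi_boundary : forall i, i \in IB -> psi (pos i) = g i)
  (u_C2star : forall eps, 0 < eps -> Ck_star beta IB 2 (u eps))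
  (u_sol : forall eps, 0 < eps -> viscous_solution H beta IB g eps (u eps)) :
  exists2 eps0 : R, 0 < eps0 &
    (exists M : R, forall eps x, 0 < eps < eps0 -> Gamma G x ->
       `|u eps x| <= M) /\
    (exists L : R, forall eps, 0 < eps < eps0 -> net_lipschitz G L (u eps)).
Proof.
have [A A0 psiA] : exists2 A, 0 < A & forall (j : edge G) y, y \in `[0, len j] ->
    `|on_edge psi j y| <= A.
  apply: (@fin_upper_bound _ _ (fun (j : edge G) a => forall y, y \in `[0, len j] ->
    `|on_edge psi j y| <= a)) => [j a b ab h y /h /le_trans|j]; first exact.
  exact: within_continuous_bounded (net_len_gt0 netG j) (on_edge_continuous psi_C2).
have [B B0 psiB] : exists2 B, 0 < B & forall (j : edge G) y, y \in `[0, len j] ->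
    `|edge_deriv2 psi j y| <= B.
  apply: (@fin_upper_bound _ _ (fun (j : edge G) a => forall y, y \in `[0, len j] ->
    `|edge_deriv2 psi j y| <= a)) => [j a b ab h y /h /le_trans|j]; first exact.
  exact: within_continuous_bounded (net_len_gt0 netG j)
    (edge_deriv2_continuous psi_C2).
have [P P0 steep] : exists2 P, 0 < P & forall (j : edge G) x r p, x \in `[0, len j] ->
    r \in `[- A, A] -> P <= `|p| -> 1 <= H j x r p.
  apply: (@fin_upper_bound _ _ (fun (j : edge G) a => forall x r p, x \in `[0, len j] ->
    r \in `[- A, A] -> a <= `|p| -> 1 <= H j x r p)) => [j a b ab h x r p xl rA bp|j].
    exact: h xl rA (le_trans ab bp).
  exact: H_coercive.
have [D D0 psiD] : exists2 D, 0 < D & forall ij : vertex G * edge G,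
    `|inward_deriv psi ij.1 ij.2| <= D.
  apply: (@fin_upper_bound _ _ (fun ij a => `|inward_deriv psi ij.1 ij.2| <= a)).
    by move=> ij a b ab h; exact: le_trans h ab.
  by move=> ij; exists `|inward_deriv psi ij.1 ij.2|.
have [C C0 Cbeta] : exists2 C, 0 < C & forall ij : vertex G * edge G,
    ij.1 \notin IB -> ij.2 \in Inc ij.1 ->
    \sum_(k in Inc ij.1) beta ij.1 k <= C * beta ij.1 ij.2.
  apply: (@fin_upper_bound _ _ (fun (ij : vertex G * edge G) a =>
    ij.1 \notin IB -> ij.2 \in Inc ij.1 ->
    \sum_(k in Inc ij.1) beta ij.1 k <= a * beta ij.1 ij.2)).
    move=> [i j] /= a b ab h iB ji.
    by apply: le_trans (h iB ji) _; rewrite ler_pM2r// beta_gt0.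
  move=> [i j] /=; exists ((\sum_(k in Inc i) beta i k) / beta i j) => iB ji.
  by rewrite divfK// gt_eqF// beta_gt0.
(* K dominates both the steepness threshold and the slopes of psi, and the
   exponent of 1 + C exceeds the length of any climbing chain. *)
pose K := P + D.
pose L := K * (1 + C) ^+ #|vertex G|.+1.
have K0 : 0 < K by rewrite addr_gt0.
have PK : P <= K by rewrite lerDl ltW.
have C1 : 1 <= 1 + C by rewrite lerDl ltW.
have PL : P <= L.
  by apply: le_trans PK _; rewrite ler_peMr ?exprn_ege1// ltW.
have L0 : 0 < L by exact: lt_le_trans PL.
have sol0 eps : 0 < eps -> forall (j : edge G) y, y \in `[0, len j] ->
    residual H eps (u eps) j y = 0.
  move=> e0; have [ode _ _] := u_sol eps e0.
  exact: (residual_eq0 netG H_cont (u_C2star eps e0).1 ode).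
have barrier eps : 0 < eps < delta / B -> forall (j : edge G) y, y \in `[0, len j] ->
    psi (curve j y) <= u eps (curve j y).
  move=> /andP[eps_gt0 eps_lt].
  have [u2 kir] := u_C2star eps eps_gt0; have [_ _ dir] := u_sol eps eps_gt0.
  apply: (comparison_strict_subsolution netG beta_gt0 eps_gt0 u2 psi_C2 H_mono).
  (* The residual with coefficient 0 is the Hamiltonian alone. *)
  - have sub (j : edge G) x : open_edge j x ->
        - 0 * pderive 2 j psi x + hamiltonian_at H j psi x <= - delta.
      by rewrite oppr0 mul0r add0r; exact: psi_sub.
    move=> j y yl; have := residual_le netG H_cont psi_C2 sub yl.
    rewrite /residual oppr0 mul0r add0r.
    have : eps * B < delta by rewrite -ltr_pdivlMr.
    have := psiB j y yl; rewrite ler_norml => /andP[Bl _].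
    have : eps * - B <= eps * edge_deriv2 psi j y by rewrite ler_pM2l.
    by lra.
  - by move=> j y yl; rewrite sol0.
  - by move=> i iB; rewrite kir// psi_transition.
  - by move=> i iB; rewrite dir// psi_boundary.
have gradient eps : 0 < eps < delta / B -> forall (j : edge G) y, y \in `[0, len j] ->
    `|edge_deriv (u eps) j y| <= L.
  move=> small; have /andP[eps_gt0 _] := small.
  have [u2 kir] := u_C2star eps eps_gt0; have [_ _ dir] := u_sol eps eps_gt0.
  have cvx : convex_where_steep G P (u eps).
    move=> j y yl Pp; have := sol0 eps eps_gt0 j y yl.
    (* Only a lower bound on u is needed to make H large: H is nondecreasing in
       u, so its value at - A, where coercivity applies, is smaller. *)
    have uA : - A <= u eps (curve j y).
      apply: le_trans (barrier eps small j y yl).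
      by have := psiA j y yl; rewrite ler_norml => /andP[].
    have AA : - A \in `[- A, A] by rewrite in_itv /= lexx; lra.
    have := steep j y (- A) _ yl AA Pp.
    move=> /le_trans /(_ (H_mono j y _ yl _ _ uA)) H1.
    rewrite /residual /on_edge /= => res.
    by rewrite -(pmulr_rgt0 _ eps_gt0); lra.
  apply: (edge_deriv_bound netG u2 cvx PL).
  apply: (inward_deriv_ge netG beta_gt0 P0 PK C1 u2 cvx kir).
    move=> i j iB ji; apply: le_trans (Cbeta (i, j) iB ji) _.
    by rewrite ler_pM2r ?beta_gt0// lerDr.
  (* At a boundary vertex u touches psi from above. *)
  move=> i j iB ji; apply: le_trans (_ : inward_deriv psi i j <= _).
    have := psiD (i, j); rewrite ler_norml => /andP[+ _].
    by apply: le_trans; rewrite lerN2 lerDr ltW.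
  apply: inward_deriv_le_at_min => // y yl.
  by rewrite psi_boundary// dir// subrr subr_ge0 barrier.
have lip eps : 0 < eps < delta / B -> net_lipschitz G L (u eps).
  move=> small; have /andP[eps_gt0 _] := small.
  have [u2 _] := u_C2star eps eps_gt0.
  apply: net_lipschitz_of_edges => // j.
  exact: lipschitz_of_iderive (fun t => @Ck_net_iderive _ _ _ _ j t u2)
    (gradient eps small j).
exists (delta / B); first by rewrite divr_gt0.
split; last by exists L.
have [[i0 i0B] _ leaf] := bdIB.
have Gi0 : Gamma G (pos i0).
  have /card_gt0P[j] : (0 < #|Inc i0|)%N by rewrite leaf.
  by rewrite inE => /set_mem ji; exists j.
have [E E0 far] : exists2 E, 0 < E & forall j : edge G,
    path_dist G (curve j 0) (pos i0) + len j <= E.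
  apply: (@fin_upper_bound _ _ (fun (j : edge G) a =>
    path_dist G (curve j 0) (pos i0) + len j <= a)).
    by move=> j a b ab h; exact: le_trans h ab.
  by move=> j; exists (path_dist G (curve j 0) (pos i0) + len j).
exists (`|g i0| + L * E) => eps x small [j _ [s /= sl <-]].
have /andP[eps_gt0 _] := small.
have [u2 _] := u_C2star eps eps_gt0; have [_ _ dir] := u_sol eps eps_gt0.
have G0 : Gamma G (curve j 0) by exists j => //; exists 0 => //; exact: start_in.
have step1 := lip eps small _ _ G0 Gi0; rewrite dir// in step1.
have step2 : `|u eps (curve j s) - u eps (curve j 0)| <= L * len j.
  have := lipschitz_of_iderive (fun t => @Ck_net_iderive _ _ _ _ j t u2)
    (gradient eps small j) sl (start_in netG j).
  move/le_trans; apply; rewrite ler_pM2l// subr0.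
  by move: sl; rewrite in_itv /= => /andP[s0 sj]; rewrite ger0_norm.
have -> : u eps (curve j s) =
  g i0 + ((u eps (curve j 0) - g i0) + (u eps (curve j s) - u eps (curve j 0))).
  by ring.
apply: le_trans (ler_normD _ _) _; rewrite lerD2l.
apply: le_trans (ler_normD _ _) _; apply: le_trans (lerD step1 step2) _.
by rewrite -mulrDr ler_pM2l.
Qed.
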